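(* Let $G$ be an $n$-vertex graph with diversity $D$ and maximum clique size $S$, and let $t\ge 2$ and $x\ge1$ be integers. There is a deterministic distributed algorithm in the LOCAL model that computes a $((t\cdot D)^x,\ S/t^x+2)$-clique-decomposition of $G$ within $\tilde O\big(x\cdot(\sqrt{D\cdot t}+\log^* n)\big)$ rounds.
   Context: LOCAL model: the input graph is the communication network; each vertex is a processor with a unique ID of $O(\log n)$ bits and unbounded local computation; computation proceeds in synchronous rounds, in each of which every vertex may send a message of arbitrary size to each neighbor; running time is the number of rounds until all vertices terminate. Global parameters ($n$, $D$, $S$, $t$, $x$) are assumed known to all vertices. For parameters $p,q>0$, a $(p,q)$-clique-decomposition of $G=(V,E)$ is a partition $U_1,\dots,U_p$ of $V$ such that every clique of each induced subgraph $G(U_i)$ has at most $q$ vertices; each vertex must learn the index of its part. The diversity of a vertex is the number of maximal cliques containing it; $D(G)$ is the maximum over all vertices. $\tilde O(f)$ hides factors polylogarithmic in the maximum degree of $G$. *)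

(* Defs.v *)
From mathcomp Require Import all_boot.
Set Implicit Arguments. Unset Strict Implicit. Unset Printing Implicit Defensive.

(* A network: vertices are identified with their (unique) IDs, which are nats. *)
Record net := Net { nV : seq nat; nE : rel nat }.

Definition wf_net (G : net) : Prop :=
  [/\ uniq (nV G),
      (forall u w, nE G u w = nE G w u),
      (forall u, ~~ nE G u u) &
      (forall u w, nE G u w -> (u \in nV G) && (w \in nV G))].

Fixpoint within (G : net) (k : nat) (v u : nat) : bool :=
  match k with
  | 0 => (u == v) && (v \in nV G)
  | k'.+1 => within G k' v u || has (fun w => within G k' v w && nE G w u) (nV G)
  end.

(* The knowledge of v after r rounds of LOCAL (full information): the set of
   vertices (IDs) at distance <= r, and all edges incident to vertices at
   distance < r.  same_view says G1 and G2 look identical from v within r rounds. *)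
Definition same_view (G1 G2 : net) (r v : nat) : Prop :=
  (forall u, within G1 r v u = within G2 r v u) /\
  (forall u w, 0 < r -> within G1 r.-1 v u -> nE G1 u w = nE G2 u w).

Definition is_clique (G : net) (K : seq nat) : bool :=
  uniq K && all (fun u => u \in nV G) K &&
  all (fun u => all (fun w => (u == w) || nE G u w) K) K.

Fixpoint subseqs (s : seq nat) : seq (seq nat) :=
  match s with
  | [::] => [:: [::]]
  | x :: s' => let r := subseqs s' in map (cons x) r ++ r
  end.

(* Each subset of the vertex set exactly once (as a sorted sequence). *)
Definition vsubsets (G : net) : seq (seq nat) := subseqs (sort leq (nV G)).

Definition is_max_clique (G : net) (K : seq nat) : bool :=
  is_clique G K &&
  all (fun u => (u \in K) || ~~ all (fun w => nE G u w) K) (nV G).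

Definition vdiversity (G : net) (v : nat) : nat :=
  count (fun K => is_max_clique G K && (v \in K)) (vsubsets G).

Definition diversity (G : net) : nat := \max_(v <- nV G) vdiversity G v.

Definition clique_number (G : net) : nat :=
  \max_(K <- vsubsets G | is_clique G K) size K.

Definition max_degree (G : net) : nat :=
  \max_(v <- nV G) size [seq u <- nV G | nE G v u].

(* (p, q)-clique-decomposition given by the part index function part:
   parts are indexed by 0..p-1, and every clique inside one part has
   at most q vertices.  Here q = S / t^x + 2 is rational, so we state
   size K <= S / t^x + 2 as size K * t^x <= S + 2 * t^x. *)
Definition is_clique_decomp_frac (G : net) (part : nat -> nat)
    (p S tx : nat) : Prop :=
  (forall v, v \in nV G -> part v < p) /\
  (forall K, is_clique G K ->
     forall i, all (fun u => part u == i) K -> size K * tx <= S + 2 * tx).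

Fixpoint logstar_fuel (f n : nat) : nat :=
  match f with
  | 0 => 0
  | f'.+1 => if n <= 1 then 0 else (logstar_fuel f' (trunc_log 2 n)).+1
  end.
Definition logstar (n : nat) : nat := logstar_fuel n n.

(* Main.v *)
Require Import Defs.
From mathcomp Require Import all_boot.
From mathcomp Require Import all_algebra all_field zify boolp.
Set Implicit Arguments. Unset Strict Implicit. Unset Printing Implicit Defensive.

(** Divide every part of every maximal clique into groups of [t] vertices and
    join two vertices lying in a common group.  This connector graph has
    degree at most [D * (t - 1)], so it has a proper colouring with
    [P = t * D] colours, and refining the partition by such a colouring divides
    the clique sizes by [t] (rounding up).  Doing this [x] times proves the
    theorem once the colouring takes about [sqrt P] rounds.

    To colour, first reduce the IDs to [poly P] colours by Linial's algorithm,
    and view such a colour as a nonconstant polynomial [f_v] of bounded degree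
    [k] over a field of characteristic 2, so that any two of them agree in at
    most [k] points.  A phase then has two loops.  In the first, [v] tries the
    classes [f_v 0, f_v 1, ...] and keeps the first one which at most [d] of its
    neighbours have chosen or are trying; inside a class this leaves at most
    [d] conflicts with vertices that decided no later.  In the second loop the
    classes are treated in turn.  Identify the palette with (a part of)
    [q * q], where [q] is about [sqrt P].  The translates [f_v + a] partition
    it, so if more than [q * k * d] colours are free at [v], one translate
    contains more than [k * d] free colours [(i, f_v i + a)].  The at most [d]
    neighbours to be avoided spoil at most [k] of them each.  A vertex still
    uncoloured after the phase has fewer than [q * k * d] uncoloured neighbours,
    whence the next phase can be run with [d / 2].

    The first phase already colours everything when the maximum degree of the
    network is below [P / 2]; otherwise [log P] phases are within the bound.
    This is what allows the algorithm not to know the maximum degree: a vertex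
    stops at the least radius whose view determines its output. *)

(** * Polynomials over GF(2^e) *)

Section EnumFrom.
Variables (T : finType) (x0 : T).
Definition enum_from : seq T := x0 :: rem x0 (enum T).

Lemma enum_from_uniq : uniq enum_from.
Proof. by rewrite /= mem_rem_uniqF ?enum_uniq ?rem_uniq ?enum_uniq. Qed.

Lemma size_enum_from : size enum_from = #|T|.
Proof.
rewrite /= size_rem ?mem_enum // prednK -?cardE //.
by apply/card_gt0P; exists x0.
Qed.

Lemma mem_enum_from x : x \in enum_from.
Proof.
rewrite inE; have := perm_to_rem (mem_enum T x0) => /perm_mem/(_ x).
by rewrite mem_enum inE => <-.
Qed.
End EnumFrom.

Section PolyFamily.
Import GRing.Theory.
Variables (F : finFieldType) (k : nat).
Local Open Scope ring_scope.

Definition poly_of (f : {ffun 'I_k -> F}) (c : F) : {poly F} :=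
  (\sum_(j < k) (f j) *: 'X^j) * 'X + c%:P.

Lemma poly_of0 c : poly_of [ffun=> 0] c = c%:P.
Proof.
by rewrite /poly_of big1 ?mul0r ?add0r // => j _; rewrite ffunE scale0r.
Qed.

Lemma poly_ofE f c :
  poly_of f c = (\poly_(j < k) oapp f 0 (insub j)) * 'X + c%:P.
Proof.
by rewrite /poly_of poly_def; congr (_ * _ + _); apply: eq_bigr => j _; rewrite valK.
Qed.

Lemma size_poly_of f c : (size (poly_of f c) <= k.+1)%N.
Proof.
rewrite poly_ofE -cons_poly_def size_cons_poly.
by case: ifP => // _; rewrite ltnS size_poly.
Qed.

Lemma coef_poly_of f c (j : 'I_k) : (poly_of f c)`_j.+1 = f j.
Proof.
by rewrite poly_ofE coefD coefMX coefC /= addr0 coef_poly ltn_ord valK.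
Qed.

(** The difference has degree at most [k], and a coefficient of positive degree survives in it
    whatever the constant terms. Hence translates of distinct polynomials also agree in at most [k]
    points. *)
Lemma poly_of_agree f g c d (r : seq F) : f != g -> uniq r ->
  (count (fun x => (poly_of f c).[x] == (poly_of g d).[x]) r <= k)%N.
Proof.
move=> fg ur.
have nz : poly_of f c - poly_of g d != 0.
  apply: contra fg; rewrite subr_eq0 => /eqP e; apply/eqP/ffunP => j.
  by rewrite -(coef_poly_of f c) e coef_poly_of.
rewrite -size_filter -ltnS.
have := @max_poly_roots _ _ [seq x <- r | (poly_of f c).[x] == (poly_of g d).[x]] nz.
rewrite filter_uniq // => /(_ _ isT) h; apply: leq_trans (h _) _.
  apply/allP => x; rewrite mem_filter => /andP[/eqP e _].
  by rewrite /root hornerD hornerN e subrr.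
apply: leq_trans (size_polyD _ _) _.
by rewrite size_polyN geq_max !size_poly_of.
Qed.
End PolyFamily.

Definition gf (e : nat) : finFieldType := s2val (pPrimePowerField (isT : prime 2) (ltn0Sn e)).

Lemma card_gf e : #|gf e| = 2 ^ e.+1.
Proof. exact: (s2valP' (pPrimePowerField (isT : prime 2) (ltn0Sn e))). Qed.

(* Elements of GF(2^e) and coefficient vectors are numbered with zero first, so
   [a = 0] gives the constant polynomials and [c] is the constant term. *)
Definition pev (e k a c i : nat) : nat :=
  let F := gf e.-1 in
  let s := enum_from (0%R : F) in
  index (poly_of (nth [ffun=> 0%R] (enum_from ([ffun=> 0%R] : {ffun 'I_k -> F})) a)
           (nth 0%R s c)).[nth 0%R s i]%R s.

Section Pev.
Import GRing.Theory.
Variables (e k : nat).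
Hypothesis e0 : 0 < e.
Let F := gf e.-1.
Let s := enum_from (0%R : F).

Lemma size_gf : size s = 2 ^ e.
Proof. by rewrite size_enum_from card_gf prednK. Qed.

Lemma pev_lt a c i : pev e k a c i < 2 ^ e.
Proof. by rewrite -size_gf index_mem mem_enum_from. Qed.

Lemma pev0 c i : c < 2 ^ e -> pev e k 0 c i = c.
Proof.
move=> hc; rewrite /pev -/F -/s [nth _ _ 0]/= poly_of0 hornerC.
by rewrite index_uniq ?enum_from_uniq // size_gf.
Qed.

(** At a fixed point, changing the constant term is a translation of the field. So the translates of
    one polynomial are disjoint and, by counting, cover the whole grid. *)
Lemma pev_inj a i c c' : c < 2 ^ e -> c' < 2 ^ e ->
  pev e k a c i = pev e k a c' i -> c = c'.
Proof.
move=> hc hc'; rewrite /pev; move/(congr1 (nth 0%R s)).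
rewrite !nth_index ?mem_enum_from // /poly_of !hornerD !hornerC.
move/addrI => h; apply/eqP; rewrite -(nth_uniq 0%R _ _ (enum_from_uniq (0%R : F))) ?size_gf //.
exact/eqP.
Qed.

Lemma pev_agree a b c d : a < 2 ^ (e * k) -> b < 2 ^ (e * k) -> a != b ->
  count (fun i => pev e k a c i == pev e k b d i) (iota 0 (2 ^ e)) <= k.
Proof.
move=> ha hb ab.
set W := enum_from ([ffun=> 0%R] : {ffun 'I_k -> F}).
have sW : size W = 2 ^ (e * k).
  by rewrite size_enum_from card_ffun card_ord card_gf prednK // expnM.
set f := nth [ffun=> 0%R] W a; set g := nth [ffun=> 0%R] W b.
have fg : f != g by rewrite nth_uniq ?sW ?enum_from_uniq.
have := poly_of_agree (nth 0%R s c) (nth 0%R s d) fg (enum_from_uniq (0%R : F)).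
apply: leq_trans; rewrite -/s -[X in _ <= count _ X](mkseq_nth 0%R s) size_gf /mkseq count_map.
apply: sub_count => i /=; rewrite /pev -/F -/s -/W -/f -/g => /eqP.
by move/(congr1 (nth 0%R s)); rewrite !nth_index ?mem_enum_from // => ->.
Qed.
End Pev.

(** * Message passing and Linial's colour reduction *)

Lemma count_has_le (T : eqType) (b : T -> nat -> bool) (ms : seq T) (r : seq nat) k :
  (forall z, z \in ms -> count (b z) r <= k) ->
  count (fun i => has (fun z => b z i) ms) r <= size ms * k.
Proof.
elim: ms => [|z ms IH] h /=; first by rewrite count_pred0.
rewrite mulSn; apply: leq_trans (leq_add (h z (mem_head _ _)) (IH _)); last first.
  by move=> w hw; apply: h; rewrite inE hw orbT.
by rewrite -count_predUI leq_addr.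
Qed.

Lemma exchange_count (T : Type) (b : T -> nat -> bool) (s : seq T) (r : seq nat) :
  \sum_(j <- r) count (fun u => b u j) s = \sum_(u <- s) count (b u) r.
Proof.
under eq_bigr do rewrite -sum1_count big_mkcond.
under [RHS]eq_bigr do rewrite -sum1_count big_mkcond.
exact: exchange_big.
Qed.

Definition pick0 (b : pred nat) (q : nat) : nat := head 0 (filter b (iota 0 q)).

Lemma pick0P b q : 0 < count b (iota 0 q) -> b (pick0 b q) /\ pick0 b q < q.
Proof.
rewrite -size_filter /pick0; case E: (filter b (iota 0 q)) => [//|x s] _ /=.
have: x \in filter b (iota 0 q) by rewrite E mem_head.
by rewrite mem_filter mem_iota => /andP[].
Qed.

Section MessagePassing.
Variable A : Type.
Definition rule := A -> seq A -> A.
Definition step (N : nat -> seq nat) (r : rule) (s : nat -> A) (v : nat) : A :=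
  r (s v) (map s (N v)).
Definition run N (rs : seq rule) (s : nat -> A) : nat -> A :=
  foldl (fun s r => step N r s) s rs.

Lemma run_cat N rs1 rs2 s : run N (rs1 ++ rs2) s = run N rs2 (run N rs1 s).
Proof. exact: foldl_cat. Qed.

Lemma run_rcons N rs r s : run N (rcons rs r) s = step N r (run N rs s).
Proof. by rewrite -cats1 run_cat. Qed.

(** The recursion follows walks, matching the way a state after [T] rules unfolds into states of
    neighbours after [T - 1] rules. *)
Fixpoint agree_upto (N N' : nat -> seq nat) (T v : nat) : Prop :=
  if T is T'.+1 then N v = N' v /\ forall u, u \in N v -> agree_upto N N' T' u
  else True.

Lemma agree_uptoW N N' T v : agree_upto N N' T.+1 v -> agree_upto N N' T v.
Proof.
elim: T v => [//|T IH] v [e h]; split=> // u /h; exact: IH.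
Qed.

Lemma run_local N N' rs s v :
  agree_upto N N' (size rs) v -> run N rs s v = run N' rs s v.
Proof.
elim/last_ind: rs v => [//|rs r IH] v; rewrite size_rcons => h.
rewrite !run_rcons /step -(IH _ (agree_uptoW h)); case: h => <- h.
by congr r; apply/eq_in_map => u hu; apply/IH/h.
Qed.
End MessagePassing.

(* [lin_col] is the ID, later its reduction by Linial's algorithm; [arb_class] is
   the class chosen in the current phase together with the time of the choice;
   [shift_of] is set while the vertex is about to pick its final colour. *)
Record state := State { lin_col : nat; final_col : option nat; arb_class : option (nat * nat); shift_of : option nat }.

(** Ensures [m * 2 ^ L < 2 ^ lin_e L m]: the field has more points than [2 ^ L] neighbours can spoil
    at [m] points each. *)
Definition lin_e L m := trunc_log 2 m + 1 + L.
Definition lin_rule L m : rule state := fun s ms =>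
  let e := lin_e L m in
  let i := pick0 (fun i => ~~ has (fun z => pev e m (lin_col z) 0 i == pev e m (lin_col s) 0 i) ms) (2 ^ e) in
  State (i * 2 ^ e + pev e m (lin_col s) 0 i) (final_col s) (arb_class s) (shift_of s).

Lemma pair_inj q i j a b : a < q -> b < q -> i * q + a = j * q + b -> i = j /\ a = b.
Proof.
move=> ha hb h; have q0 : 0 < q by exact: leq_ltn_trans ha.
have e : i = j.
  by move: (congr1 (divn^~ q) h); rewrite /= !divnMDl // !divn_small // !addn0.
by split=> //; move: h; rewrite e => /addnI.
Qed.

Section Graph.
Variables (N : nat -> seq nat) (V : pred nat) (P : nat).
Hypothesis Nsym : forall u v, u \in N v -> v \in N u.
Hypothesis NV : forall u v, u \in N v -> V u.
Hypothesis Ndeg : forall v, V v -> size (N v) < P.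

Definition proper_ids m (s : nat -> state) :=
  (forall v, V v -> lin_col (s v) < 2 ^ m) /\
  (forall u v, u \in N v -> lin_col (s u) != lin_col (s v)).

(** A colour numbers a polynomial of degree at most [m] with zero constant term. Fewer than [P]
    neighbours, each agreeing with it in at most [m] points, leave a point of disagreement with all
    of them; this point and the value there form the new colour. *)
Lemma lin_step L m s : P <= 2 ^ L -> proper_ids m s ->
  proper_ids (lin_e L m + lin_e L m) (step N (lin_rule L m) s).
Proof.
move=> PL [hb hp]; set e := lin_e L m; set q := 2 ^ e.
have e0 : 0 < e by rewrite /e /lin_e addn1.
have q0 : 0 < q by rewrite expn_gt0.
pose bad v i := has (fun z => pev e m (lin_col z) 0 i == pev e m (lin_col (s v)) 0 i) (map s (N v)).
have lt_m x : x < 2 ^ m -> x < 2 ^ (e * m).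
  by move=> h; apply: leq_trans h _; rewrite leq_exp2l // leq_pmull.
have key v : V v -> ~~ bad v (pick0 (fun i => ~~ bad v i) q) /\ pick0 (fun i => ~~ bad v i) q < q.
  move=> Vv; apply: (@pick0P (fun i => ~~ bad v i)).
  have: count (bad v) (iota 0 q) <= size (map s (N v)) * m.
    have bE : bad v =1 (fun i => has (fun u => pev e m (lin_col (s u)) 0 i == pev e m (lin_col (s v)) 0 i) (N v)).
      by move=> i; rewrite /bad has_map.
    rewrite (eq_count bE) size_map.
    apply: (@count_has_le _ (fun u i => pev e m (lin_col (s u)) 0 i == pev e m (lin_col (s v)) 0 i)).
    move=> u hu; apply: pev_agree => //; first by apply/lt_m/hb/(NV hu).
      exact/lt_m/hb.
    exact: hp.
  rewrite size_map; have := count_predC (bad v) (iota 0 q); rewrite size_iota.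
  have : size (N v) * m < q.
    apply: (@leq_ltn_trans (2 ^ L * m)).
      by rewrite leq_mul2r (leq_trans (ltnW (Ndeg Vv)) PL) orbT.
    by rewrite /q /e /lin_e expnD mulnC ltn_pmul2r ?expn_gt0 // addn1 trunc_log_ltn.
  change (count (fun i => ~~ bad v i) _) with (count (predC (bad v)) (iota 0 q)).
  by lia.
have sE v : lin_col (step N (lin_rule L m) s v) =
   pick0 (fun i => ~~ bad v i) q * q + pev e m (lin_col (s v)) 0 (pick0 (fun i => ~~ bad v i) q).
  by [].
split=> [v Vv|u v uv]; rewrite !sE.
  case: (key v Vv) => _ h; rewrite expnD -/q.
  have := pev_lt m e0 (lin_col (s v)) 0 (pick0 (fun i => ~~ bad v i) q); rewrite -/q.
  by move: (pick0 _ _) (pev _ _ _ _ _) h => i y; nia.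
apply/eqP => /pair_inj; rewrite !pev_lt // => /(_ isT isT) [e1 e2].
have [] := key v (NV (Nsym uv)); rewrite {1}/bad has_map => /hasPn hn _.
by move: (hn _ uv); rewrite /= -e2 e1 eqxx.
Qed.

End Graph.

(** * One phase *)

Lemma inj_surj_iota (f : nat -> nat) q y :
  (forall c, c < q -> f c < q) ->
  (forall c c', c < q -> c' < q -> f c = f c' -> c = c') ->
  y < q -> exists2 c, c < q & f c = y.
Proof.
move=> hf hi hy.
have ui : uniq (map f (iota 0 q)).
  rewrite map_inj_in_uniq ?iota_uniq // => c c'; rewrite !mem_iota; exact: hi.
have hs : {subset map f (iota 0 q) <= iota 0 q}.
  by move=> _ /mapP[c hc ->]; move: hc; rewrite !mem_iota; apply: hf.
have [|_ /(_ y)] := uniq_min_size ui hs; first by rewrite size_map.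
by rewrite mem_iota hy /= => /mapP[c]; rewrite mem_iota => hc ->; exists c.
Qed.

Section PhaseRules.
Variables (P e ep k : nat).
Let q := 2 ^ e.
Let p := 2 ^ ep.

(** The successor skips number 0, that of the constant polynomials. A class already chosen then
    counts as a constant polynomial, distinct from every trial polynomial. *)
Definition trial (s : state) (i : nat) : nat := pev ep k (lin_col s).+1 0 i.
Definition current (i : nat) (s : state) : nat :=
  if arb_class s is Some (b, _) then b else trial s i.

Definition reset_rule : rule state := fun s _ => State (lin_col s) (final_col s) None None.

Definition class_rule (d i : nat) : rule state := fun s ms =>
  if [&& final_col s == None, arb_class s == None &
      count (fun z => (final_col z == None) && (current i z == trial s i)) ms <= d]
  then State (lin_col s) (final_col s) (Some (trial s i, i)) (shift_of s) else s.

Definition free (ms : seq state) : seq nat :=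
  [seq y <- iota 0 P | all (fun z => final_col z != Some y) ms].
Definition cell (s : state) (c i : nat) : nat := i * q + pev e k (lin_col s).+1 c i.
Definition hits (s : state) (ms : seq state) (c : nat) : nat :=
  count (fun i => cell s c i \in free ms) (iota 0 q).

Definition shift_rule (d b : nat) : rule state := fun s ms =>
  State (lin_col s) (final_col s) (arb_class s)
    (if [&& final_col s == None, omap fst (arb_class s) == Some b & q * k * d < size (free ms)]
     then Some (pick0 (fun c => k * d < hits s ms c) q) else None).

Definition time (s : state) : nat := if arb_class s is Some (_, t) then t else 0.
(** Only neighbours whose class was chosen no later are avoided, which keeps their number at most
    [d]. A later neighbour does the avoiding itself, and in a tie both do. *)
Definition conflict (s : state) (c i : nat) (z : state) : bool :=
  if shift_of z is Some c' then (time z <= time s) && (cell z c' i == cell s c i) else false.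

Definition color_rule : rule state := fun s ms =>
  if (final_col s, shift_of s) is (None, Some c) then
    State (lin_col s)
      (Some (cell s c (pick0 (fun i => (cell s c i \in free ms) && ~~ has (conflict s c i) ms) q)))
      (arb_class s) None
  else s.

Definition class_rules d : seq (rule state) := [seq class_rule d i | i <- iota 0 p].
Definition pick_rules d : seq (rule state) :=
  flatten [seq [:: shift_rule d b; color_rule] | b <- iota 0 p].
Definition phase_rules d : seq (rule state) :=
  reset_rule :: class_rules d ++ pick_rules d.

Lemma size_phase_rules d : size (phase_rules d) = 3 * p + 1.
Proof.
rewrite /= size_cat size_map size_iota size_flatten /shape -map_comp.
rewrite (_ : sumn _ = p * 2); first by lia.
by rewrite -[in RHS](size_iota 0 p); elim: (iota 0 p) => //= _ s ->.
Qed.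
End PhaseRules.

Section Phase.
Variables (N : nat -> seq nat) (V : pred nat) (P e ep k : nat).
Hypothesis Nsym : forall u v, u \in N v -> v \in N u.
Hypothesis NV : forall u v, u \in N v -> V u.
Hypothesis Ndeg : forall v, V v -> size (N v) < P.
Let q := 2 ^ e.
Let p := 2 ^ ep.
Hypothesis (e0 : 0 < e) (eep : e <= ep) (Pq : P <= q * q).

Definition good (s : nat -> state) :=
  [/\ forall v, V v -> (lin_col (s v)).+1 < 2 ^ (e * k),
      forall u v, u \in N v -> lin_col (s u) != lin_col (s v) &
      forall v y, V v -> final_col (s v) = Some y ->
        y < P /\ forall u, u \in N v -> final_col (s u) != Some y].

Definition udeg (s : nat -> state) v := count (fun u => final_col (s u) == None) (N v).

Let ep0 : 0 < ep. Proof. exact: leq_trans e0 eep. Qed.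

Let lt_ep x : x < 2 ^ (e * k) -> x < 2 ^ (ep * k).
Proof. by move=> h; apply: leq_trans h _; rewrite leq_exp2l // leq_mul2r eep orbT. Qed.

Definition earlier (y t : nat) (o : option (nat * nat)) : bool :=
  if o is Some (y', t') then (y' == y) && (t' <= t) else false.

(** * First loop: choosing classes with few conflicts *)

Section ClassLoop.
Variables (s0 : nat -> state) (d : nat).
Hypothesis good0 : good s0.
Hypothesis cls0 : forall v, arb_class (s0 v) = None.

(** The record of a failed trial [j] refers to the present class of [u], not to its state in round
    [j]. This is sound because a chosen class never changes, and it lets failures be counted
    neighbour by neighbour at the end. *)
Definition class_inv i (s : nat -> state) :=
  (forall v, [/\ lin_col (s v) = lin_col (s0 v), final_col (s v) = final_col (s0 v) & shift_of (s v) = shift_of (s0 v)]) /\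
  forall v, V v -> final_col (s0 v) = None ->
    match arb_class (s v) with
    | None => forall j, j < i ->
       d < count (fun u => (final_col (s0 u) == None) &&
         ((trial ep k (s0 u) j == trial ep k (s0 v) j) ||
          (omap fst (arb_class (s u)) == Some (trial ep k (s0 v) j)))) (N v)
    | Some (y, t) => [/\ t < i, y < p &
        count (fun u => (final_col (s0 u) == None) && earlier y t (arb_class (s u))) (N v) <= d]
    end.

Lemma trialE s v j : lin_col (s v) = lin_col (s0 v) -> trial ep k (s v) j = trial ep k (s0 v) j.
Proof. by rewrite /trial => ->. Qed.

(** Later choices carry a later time, so the count of a decided vertex never grows. At the moment of
    choice it is bounded by the test in [class_rule], which includes the neighbours trying the same
    class simultaneously. *)
Lemma class_inv_step i s : class_inv i s -> class_inv i.+1 (step N (class_rule ep k d i) s).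
Proof.
move=> [hf hc]; set s' := step _ _ _.
have fE v : [/\ lin_col (s' v) = lin_col (s0 v), final_col (s' v) = final_col (s0 v) & shift_of (s' v) = shift_of (s0 v)].
  by rewrite /s' /step /class_rule; case: ifP => _ /=; apply: hf.
split=> //.
pose C v := count (fun u => (final_col (s0 u) == None) &&
  (current ep k i (s u) == trial ep k (s0 v) i)) (N v) <= d.
have sE v : arb_class (s' v) = if [&& final_col (s0 v) == None, arb_class (s v) == None & C v]
   then Some (trial ep k (s0 v) i, i) else arb_class (s v).
  rewrite /s' /step /class_rule count_map; case: (hf v) => ha -> _.
  rewrite (trialE _ ha) /C;
  have -> : count (fun u => (final_col (s u) == None) && (current ep k i (s u) == trial ep k (s0 v) i)) (N v)
    = count (fun u => (final_col (s0 u) == None) && (current ep k i (s u) == trial ep k (s0 v) i)) (N v).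
    by apply: eq_count => u; case: (hf u) => _ -> _.
  by case: ifP.
have mono u b : omap fst (arb_class (s u)) == Some b -> omap fst (arb_class (s' u)) == Some b.
  rewrite sE; case: ifP => // /and3P[_ /eqP -> _] //.
have back u y t : t < i -> earlier y t (arb_class (s' u)) -> earlier y t (arb_class (s u)).
  move=> ti; rewrite sE; case: ifP => // _ /= /andP[_]; lia.
move=> v Vv cv; have := hc v Vv cv; rewrite [arb_class (s' v)]sE cv eqxx /=.
case Es: (arb_class (s v)) => [[y t]|] /=.
  case=> ti yp h; split=> //; first exact: ltnW.
  apply: leq_trans h; apply: sub_count => u /= /andP[-> /=]; exact: back.
move=> h; case: ifP => [Cv|/negbT Cv].
  split=> //; first by rewrite pev_lt.
  apply: leq_trans Cv; apply: sub_count => u /= /andP[cu]; rewrite cu /=.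
  rewrite sE cu /= /current; case Eu: (arb_class (s u)) => [[y t]|] /=.
    by case/andP.
  by case: ifP => //= _ /andP[]; rewrite (trialE _ (let: And3 a _ _ := hf u in a)).
move=> j; rewrite ltnS leq_eqVlt => /orP[/eqP -> {j}|ji].
  rewrite -ltnNge in Cv; apply: leq_trans Cv _; apply: sub_count => u /= /andP[-> /=].
  rewrite /current; case Eu: (arb_class (s u)) => [[y t]|] /=.
    by move=> hy; rewrite mono ?orbT // Eu.
  by rewrite (trialE _ (let: And3 a _ _ := hf u in a)) => ->.
apply: leq_trans (h j ji) _; apply: sub_count => u /= /andP[-> /=] /orP[->//|/mono ->].
by rewrite orbT.
Qed.

Lemma class_loop_inv i : class_inv i (run N [seq class_rule ep k d j | j <- iota 0 i] s0).
Proof.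
elim: i => [|i IH].
  by split=> // v Vv cv; rewrite /= cls0.
by rewrite -addn1 iotaD map_cat run_cat /= add0n addn1; apply: class_inv_step.
Qed.

(** Double counting: if [v] never decided, each of the [p] trials met more than [d] neighbours, but
    an uncoloured neighbour is met at most [2 * k] times, [k] for its polynomial and [k] for its
    final class. *)
Lemma class_loop D : (forall v, V v -> final_col (s0 v) = None -> udeg s0 v <= D) ->
  2 * k * D < p * d.+1 ->
  let s := run N (class_rules ep k d) s0 in
  (forall v, [/\ lin_col (s v) = lin_col (s0 v), final_col (s v) = final_col (s0 v) & shift_of (s v) = shift_of (s0 v)]) /\
  forall v, V v -> final_col (s0 v) = None ->
    exists y t, [/\ arb_class (s v) = Some (y, t), y < p &
      count (fun u => (final_col (s0 u) == None) && earlier y t (arb_class (s u))) (N v) <= d].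
Proof.
move=> hD hp s; have [hf hc] := class_loop_inv p; split=> // v Vv cv.
have := hc v Vv cv; rewrite -/(class_rules ep k d) -/s.
case Es: (arb_class (s v)) => [[y t]|]; first by case=> _ h1 h2; exists y, t.
move=> h; exfalso.
pose B u j := (final_col (s0 u) == None) &&
         ((trial ep k (s0 u) j == trial ep k (s0 v) j) ||
          (omap fst (arb_class (s u)) == Some (trial ep k (s0 v) j))).
have lo : p * d.+1 <= \sum_(j <- iota 0 p) count (fun u => B u j) (N v).
  have -> : p * d.+1 = \sum_(j <- iota 0 p) d.+1.
    by rewrite big_const_seq count_predT size_iota iter_addn_0 mulnC.
  by rewrite [X in X <= _]big_seq [X in _ <= X]big_seq; apply: leq_sum => j; rewrite mem_iota => /h.
have hi : \sum_(u <- N v) count (B u) (iota 0 p) <= udeg s0 v * (2 * k).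
  rewrite /udeg -sum1_count big_distrl /= [X in _ <= X]big_mkcond.
  rewrite big_seq [X in _ <= X]big_seq; apply: leq_sum => u uv.
  rewrite mul1n /B; case: eqP => cu /=; last by rewrite count_pred0.
  have Vu := NV uv; case: good0 => hb hn _.
  have hau : (lin_col (s0 u)).+1 < 2 ^ (ep * k) by apply/lt_ep/hb.
  have hav : (lin_col (s0 v)).+1 < 2 ^ (ep * k) by apply/lt_ep/hb.
  rewrite -[X in X <= _]addn0; apply: leq_trans (_ : _ <= k + k) _; last by lia.
  rewrite addn0; apply: leq_trans (leq_trans (leq_addr _ _) (eq_leq (count_predUI _ _ _))) _.
  apply: leq_add.
    by apply: pev_agree => //; rewrite eqSS; apply: hn.
  have := hc u Vu cu; rewrite -/(class_rules ep k d) -/s.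
  case: (arb_class (s u)) => [[b t] [_ bp _]|_] /=; last by rewrite count_pred0.
  (* The final class [b] of [u] is read as a constant polynomial, which has number 0. *)
  rewrite (@eq_count _ _ (fun j => pev ep k 0 b j == pev ep k (lin_col (s0 v)).+1 0 j)).
    by apply: pev_agree => //; rewrite expn_gt0.
  by move=> j; rewrite pev0.
have := hD v Vv cv; rewrite exchange_count in lo; nia.
Qed.
End ClassLoop.

(** * Second loop: colouring class by class *)

Section PickLoop.
Variables (s1 : nat -> state) (d : nat).
Hypothesis cls1 : forall v, V v -> final_col (s1 v) = None ->
    exists y t, [/\ arb_class (s1 v) = Some (y, t), y < p &
      count (fun u => (final_col (s1 u) == None) && earlier y t (arb_class (s1 u))) (N v) <= d].

Definition pick_inv b (s : nat -> state) :=
  [/\ forall v, lin_col (s v) = lin_col (s1 v) /\ arb_class (s v) = arb_class (s1 v),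
      forall v y, final_col (s1 v) = Some y -> final_col (s v) = Some y,
      good s &
      forall v y t, V v -> final_col (s v) = None -> arb_class (s1 v) = Some (y, t) -> y < b ->
        udeg s v < q * k * d /\ P - size (N v) <= q * k * d].

Let freel (s : nat -> state) v := free P (map s (N v)).

Lemma mem_freel s v y : y \in freel s v -> y < P /\ forall u, u \in N v -> final_col (s u) != Some y.
Proof.
rewrite /freel mem_filter mem_iota all_map => /andP[/allP h /andP[_ ?]]; split=> // u; exact: h.
Qed.

Lemma size_freel s v : P <= size (freel s v) + count (fun u => final_col (s u) != None) (N v).
Proof.
rewrite /freel /free size_filter -{1}(size_iota 0 P) -(count_predC (fun y => all (fun z => final_col z != Some y) (map s (N v)))).
rewrite leq_add2l -size_filter.
pose w := [seq u <- N v | final_col (s u) != None]; rewrite -size_filter -/w size_filter -[size w]muln1.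
rewrite (@eq_count _ _ (fun y => has (fun u => final_col (s u) == Some y) w)).
  apply: (@count_has_le _ (fun u y => final_col (s u) == Some y)) => u _.
  case: (final_col (s u)) => [c|]; last by rewrite (@eq_count _ _ pred0) ?count_pred0.
  rewrite (@eq_count _ _ (pred1 c)); last by move=> y /=; rewrite eq_sym.
  by rewrite count_uniq_mem ?iota_uniq // leq_b1.
move=> y; rewrite /= -has_predC has_map; apply/hasP/hasP => -[u].
  rewrite /= negbK => hu /eqP e1; exists u; last exact/eqP.
  by rewrite mem_filter hu e1.
by rewrite mem_filter => /andP[_ hu] e1; exists u; rewrite //= e1.
Qed.

Lemma udeg_lt s v : V v -> udeg s v < size (freel s v).
Proof.
move=> Vv; have := size_freel s v; have := Ndeg Vv.
rewrite -(count_predC (fun u => final_col (s u) == None) (N v)) /udeg.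
change (count (predC _) _) with (count (fun u => final_col (s u) != None) (N v)); lia.
Qed.

Lemma free_slack s v : P - size (N v) <= size (freel s v).
Proof.
have := size_freel s v; have := count_size (fun u => final_col (s u) != None) (N v); lia.
Qed.

(** Averaging: the [q] translates cover the palette, so with at most [k * d] free colours in each
    there would be at most [q * k * d] in all. *)
Lemma good_shift s v : q * k * d < size (freel s v) ->
  exists2 c, c < q & k * d < hits P e k (s v) (map s (N v)) c.
Proof.
move=> hL.
have [|/hasPn hn] := boolP (has (fun c => k * d < hits P e k (s v) (map s (N v)) c) (iota 0 q)).
  by move=> /hasP[c]; rewrite mem_iota => ? ?; exists c.
exfalso; move: hL; rewrite ltnNge => /negP; apply.
pose A := [seq cell e k (s v) c i | c <- iota 0 q, i <- iota 0 q].
have sub : size (freel s v) <= count (fun y => y \in freel s v) A.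
  rewrite -size_filter; apply: uniq_leq_size; first by rewrite filter_uniq ?iota_uniq.
  move=> y hy; rewrite mem_filter hy /=; have [yP _] := mem_freel hy.
  have q0 : 0 < q by rewrite expn_gt0.
  (* The colour [y] sits at point [y %/ q] with value [y %% q]; some translate passes through it. *)
  have [c hc ec] := @inj_surj_iota (fun c => pev e k (lin_col (s v)).+1 c (y %/ q)) q (y %% q)
     (fun c _ => pev_lt k e0 _ _ _) (fun c c' h h' => pev_inj e0 h h') (ltn_pmod y q0).
  apply/allpairsP; exists (c, y %/ q); rewrite !mem_iota /= hc; split=> //.
    by rewrite ltn_divLR // (leq_trans yP).
  by rewrite /cell ec -/q -divn_eq.
apply: leq_trans sub _; rewrite /A count_flatten -map_comp.
rewrite sumnE big_map -mulnA.
have -> : q * (k * d) = \sum_(j <- iota 0 q) k * d.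
  by rewrite big_const_seq count_predT size_iota iter_addn_0 mulnC.
rewrite big_seq [X in _ <= X]big_seq; apply: leq_sum => c /hn; rewrite -leqNgt.
by rewrite /= count_map.
Qed.

Lemma pick_inv_step b s : b < p -> pick_inv b s ->
  pick_inv b.+1 (step N (color_rule P e k) (step N (shift_rule P e k d b) s)).
Proof.
move=> bp [hf hm hg hd].
set s' := step N (shift_rule P e k d b) s; set s2 := step N _ s'.
pose act v := [&& final_col (s v) == None, omap fst (arb_class (s v)) == Some b & q * k * d < size (freel s v)].
pose c v := pick0 (fun c => k * d < hits P e k (s v) (map s (N v)) c) q.
have s'E v : s' v = State (lin_col (s v)) (final_col (s v)) (arb_class (s v)) (if act v then Some (c v) else None) by [].
have cellE v c0 i : cell e k (s' v) c0 i = cell e k (s v) c0 i by rewrite /cell s'E.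
have timeE v : time (s' v) = time (s v) by rewrite /time s'E.
have scE v : shift_of (s' v) = if act v then Some (c v) else None by rewrite s'E.
clearbody s'.
have freeE v : free P (map s' (N v)) = freel s v.
  by apply: eq_filter => y; rewrite !all_map; apply: eq_all => u /=; rewrite s'E.
pose i_ v := pick0 (fun i => (cell e k (s' v) (c v) i \in free P (map s' (N v))) &&
   ~~ has (conflict e k (s' v) (c v) i) (map s' (N v))) q.
have s2E v : s2 v = if act v then State (lin_col (s v)) (Some (cell e k (s v) (c v) (i_ v))) (arb_class (s v)) None
   else s' v.
  rewrite /s2 {1}/step /color_rule /i_ s'E /=; case av: (act v); last by case: (final_col _).
  by case/and3P: av => /eqP ->.
clearbody s2.
have actcls v : act v -> exists t, arb_class (s1 v) = Some (b, t) /\ time (s v) = t.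
  case/and3P=> _ + _; case: (hf v) => _ e1; rewrite /time e1; case: (arb_class (s1 v)) => [[y t]|] //=.
  by move/eqP=> [->]; exists t.
have unc v : final_col (s v) = None -> final_col (s1 v) = None.
  by case E: (final_col (s1 v)) => [y|] //; rewrite (hm _ _ E).
case: (hg) => ga gn gc.
(* At most [d] acting neighbours have chosen the class no later, and each spoils at most [k] cells
   of the translate, which has more than [k * d] free ones. *)
have key v : V v -> act v -> (cell e k (s v) (c v) (i_ v) \in freel s v) /\
   forall u, u \in N v -> act u -> time (s u) <= time (s v) ->
      cell e k (s u) (c u) (i_ u) != cell e k (s v) (c v) (i_ v).
  move=> Vv av; have [t [clv tv]] := actcls v av.
  have /and3P[/eqP cv _ hL] := av.
  have hc : k * d < hits P e k (s v) (map s (N v)) (c v).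
    have [c1 hc1 hh] := good_shift hL.
    have [|//] := @pick0P (fun c => k * d < hits P e k (s v) (map s (N v)) c) q.
    by rewrite -has_count; apply/hasP; exists c1 => //; rewrite mem_iota.
  have [y' [t' [cl1 _ hcnt]]] := cls1 Vv (unc _ cv).
  move: cl1; rewrite clv => -[??]; subst y' t'.
  have hb : count (fun i => has (conflict e k (s' v) (c v) i) (map s' (N v))) (iota 0 q) <= d * k.
    pose w := [seq u <- N v | (final_col (s1 u) == None) && earlier b t (arb_class (s1 u))].
    apply: (@leq_trans (count (fun i => has (fun u => conflict e k (s' v) (c v) i (s' u)) w) (iota 0 q))).
      apply: sub_count => i /=; rewrite has_map => /hasP[u hu /= cf].
      apply/hasP; exists u => //; rewrite mem_filter hu andbT.
      move: cf; rewrite /conflict scE; case: ifP => // au /andP[].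
      have [t' [clu tu]] := actcls u au; have /and3P[/eqP cu _ _] := au.
      by rewrite (unc _ cu) clu /= eqxx !timeE tu tv.
    apply: (@leq_trans (size w * k)); last by rewrite leq_mul2r size_filter hcnt orbT.
    apply: (@count_has_le _ (fun u i => conflict e k (s' v) (c v) i (s' u))) => u.
    rewrite mem_filter => /andP[_ uv].
    apply: leq_trans (pev_agree e0 (c u) (c v) (ga _ (NV uv)) (ga _ Vv) _); last first.
      by rewrite eqSS; apply: gn.
    apply: sub_count => i; rewrite /conflict scE; case: ifP => // au /andP[_].
    by rewrite !cellE /cell eqn_add2l.
  have [] := @pick0P (fun i => (cell e k (s' v) (c v) i \in free P (map s' (N v))) &&
     ~~ has (conflict e k (s' v) (c v) i) (map s' (N v))) q.
    rewrite lt0n; apply/negP => /eqP h0.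
    have: hits P e k (s v) (map s (N v)) (c v) <= d * k.
      apply: leq_trans hb.
      have := count_predUI (fun i => has (conflict e k (s' v) (c v) i) (map s' (N v)))
       (fun i => (cell e k (s' v) (c v) i \in free P (map s' (N v))) &&
         ~~ has (conflict e k (s' v) (c v) i) (map s' (N v))) (iota 0 q).
      rewrite h0 addn0 => <-; apply: leq_trans (leq_addr _ _); apply: sub_count => i /= hi.
      rewrite freeE; case: has => //=; by rewrite cellE andbT.
    by rewrite leqNgt mulnC hc.
  rewrite -/(i_ v) freeE => /andP[h1 /negP h2] iq; rewrite cellE in h1.
  split; first exact: h1.
  move=> u uv au htuv; apply/eqP => eq; apply: h2; rewrite has_map; apply/hasP; exists u; first exact: uv.
  rewrite /=; have [ei ep_] := pair_inj (pev_lt k e0 _ _ _) (pev_lt k e0 _ _ _) eq.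
  rewrite /conflict scE au !timeE htuv /= !cellE.
  by rewrite /cell eqn_add2l -ep_ ei eqxx.
have col2 v : final_col (s2 v) = if act v then Some (cell e k (s v) (c v) (i_ v)) else final_col (s v).
  by rewrite s2E; case: ifP; rewrite ?s'E.
have colm v y : final_col (s v) = Some y -> final_col (s2 v) = Some y.
  by rewrite col2 /act => ->.
split.
- move=> v; rewrite s2E; case: (hf v) => <- <-; by case: ifP => //; rewrite s'E.
- by move=> v y /hm /colm.
- split.
  + by move=> v Vv; rewrite s2E; case: ifP => _; rewrite ?s'E /=; apply: ga.
  + move=> u v uv; have saE w : lin_col (s2 w) = lin_col (s w) by rewrite s2E; case: ifP => //; rewrite s'E.
    by rewrite !saE; apply: gn.
  + move=> v y Vv; rewrite col2; case: ifP => [av [<-]|nav cv].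
      have [h1 h2] := key v Vv av; have [h3 h4] := mem_freel h1; split=> // u uv.
      rewrite col2; case: ifP => [au|_]; last exact: h4.
      apply/eqP => /Some_inj eq; have Vu := NV uv.
      (* When two adjacent vertices are coloured together, the one whose class was chosen later has
         avoided the other. *)
      case: (leqP (time (s u)) (time (s v))) => [le|/ltnW le].
        by move: (h2 u uv au le); rewrite eq eqxx.
      by have [_ h5] := key u Vu au; move: (h5 v (Nsym uv) av le); rewrite eq eqxx.
    have [h1 h2] := gc v y Vv cv; split=> // u uv; rewrite col2; case: ifP => [au|_]; last exact: h2.
    have [h3 h4] := key u (NV uv) au; have [_ h5] := mem_freel h3.
    apply/eqP => -[eq]; move: (h5 v (Nsym uv)); rewrite eq cv eqxx //.
- move=> v y t Vv; rewrite col2; case: ifP => // nav cv clv; rewrite ltnS leq_eqVlt => yb.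
  have ud : udeg s2 v <= udeg s v.
    apply: sub_count => u /= /eqP; case E: (final_col (s u)) => [y'|] //.
    by rewrite (colm _ _ E).
  case/orP: yb => [/eqP yb|yb]; last first.
    by have [h1 h2] := hd v y t Vv cv clv yb; split=> //; apply: leq_ltn_trans h1.
  (* A vertex of class [b] still uncoloured did not act, so it had at most [q * k * d] free
     colours. *)
  move: nav; rewrite /act cv (proj2 (hf v)) clv yb /= eqxx /= => /negbT; rewrite -leqNgt => hL.
  split; last exact: leq_trans (free_slack s v) hL.
  apply: leq_ltn_trans ud _; exact: leq_trans (udeg_lt s Vv) hL.
Qed.

Lemma pick_loop : good s1 -> pick_inv p (run N (pick_rules P e ep k d) s1).
Proof.
move=> g1; rewrite /pick_rules -/p.
suff H b : b <= p ->
    pick_inv b (run N (flatten [seq [:: shift_rule P e k d b; color_rule P e k] | b <- iota 0 b]) s1).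
  exact: H.
elim: b => [|b IH] hb; first by split.
rewrite -addn1 iotaD map_cat flatten_cat run_cat add0n addn1.
by apply: pick_inv_step => //; apply/IH/ltnW.
Qed.
End PickLoop.

(** The bound on [udeg] serves as [D] for the next phase; the bound on [P - size (N v)] shows that
    no vertex of small degree is left uncoloured. *)
Lemma phase_spec d D s : good s ->
  (forall v, V v -> final_col (s v) = None -> udeg s v <= D) -> 2 * k * D < p * d.+1 ->
  let s' := run N (phase_rules P e ep k d) s in
  good s' /\ forall v, V v -> final_col (s' v) = None ->
     udeg s' v < q * k * d /\ P - size (N v) <= q * k * d.
Proof.
move=> gs hD hp s'.
pose s0 := step N reset_rule s.
have g0 : good s0 by case: gs.
have [hf hc] := class_loop (s0 := s0) g0 (fun=> erefl) (D := D) hD hp.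
set s1 := run N (class_rules ep k d) s0 in hf hc.
have saE v : lin_col (s1 v) = lin_col (s0 v) by case: (hf v).
have coE v : final_col (s1 v) = final_col (s0 v) by case: (hf v).
have g1 : good s1.
  case: g0 => h1 h2 h3; split=> [v|u v|v y]; rewrite ?saE ?coE.
  - exact: h1.
  - exact: h2.
  - by move=> Vv cv; have [? h] := h3 v y Vv cv; split=> // u uv; rewrite coE; apply: h.
have cls1 v : V v -> final_col (s1 v) = None -> exists y t, [/\ arb_class (s1 v) = Some (y, t), y < p &
      count (fun u => (final_col (s1 u) == None) && earlier y t (arb_class (s1 u))) (N v) <= d].
  rewrite coE => Vv /(hc v Vv) [y [t [h1 h2 h3]]]; exists y, t; split=> //.
  by apply: leq_trans h3; apply: sub_count => u /=; rewrite coE.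
have -> : s' = run N (pick_rules P e ep k d) s1.
  by rewrite /s' /phase_rules /= run_cat.
have [_ hm g2 h2] := pick_loop cls1 g1.
split=> // v Vv cv.
have [|y [t [cl yp _]]] := cls1 v Vv; last exact: h2 cl yp.
by case E: (final_col (s1 v)) => [y|] //; rewrite (hm _ _ E) in cv.
Qed.
End Phase.

Lemma phase_keeps N P e ep k d s v y : final_col (s v) = Some y ->
  final_col (run N (phase_rules P e ep k d) s v) = Some y.
Proof.
move=> cv; rewrite /phase_rules -cat1s !run_cat /=.
set s0 := step _ _ s; have : final_col (s0 v) = Some y by [].
move: s0 => {cv}s cv.
have {}cv : final_col (run N (class_rules ep k d) s v) = Some y.
  rewrite /class_rules; elim: (iota _ _) s cv => //= i r IH s cv; apply: IH.
  by rewrite /step /class_rule cv.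
move: (run _ _ _) cv => {}s; rewrite /pick_rules.
elim: (iota _ _) s => //= b r IH s cv; apply: IH.
by rewrite /step /color_rule /shift_rule /= cv.
Qed.

(** * The colouring algorithm *)

Lemma trunc_log_leq_lt n B : n < 2 ^ B.+1 -> trunc_log 2 n <= B.
Proof.
case: n => [|n] h; first by rewrite trunc_log0.
rewrite -ltnS -(ltn_exp2l (m := 2)) //; apply: leq_ltn_trans h; exact: trunc_logP.
Qed.

Lemma trunc_log_lt_self n : 0 < n -> trunc_log 2 n < n.
Proof. by case: n => // n _; rewrite ltnS; apply/trunc_log_leq_lt/ltn_expl. Qed.

Lemma logstarP n : iter (logstar n) (trunc_log 2) n <= 1.
Proof.
rewrite /logstar.
suff H f m : m <= f -> iter (logstar_fuel f m) (trunc_log 2) m <= 1 by exact: H.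
elim: f m => [|f IH] m; first by case: m.
move=> hm; rewrite [logstar_fuel _ _]/=; case: (leqP m 1) => [//|m1]; rewrite iterSr; apply: IH.
rewrite -ltnS; apply: leq_trans hm; apply: trunc_log_lt_self; exact: ltnW.
Qed.

Definition next_bits L m := lin_e L m + lin_e L m.

(** Here [y] runs through the iterated logarithms of [n]. Keeping the number of bits below a linear
    function of [y] makes [logstar n] steps suffice for IDs up to [n ^ c]. *)
Lemma next_bits_bound c L m y : m <= (c + 2) * y + (4 * L + 4 * c + 20) ->
  next_bits L m <= (c + 2) * trunc_log 2 y + (4 * L + 4 * c + 20).
Proof.
move=> hm.
suff : trunc_log 2 m <= trunc_log 2 y + L + 2 * c + 8.
  by rewrite /next_bits /lin_e; move: (trunc_log 2 y) (trunc_log 2 m) => a b; nia.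
apply: trunc_log_leq_lt.
have -> : (trunc_log 2 y + L + 2 * c + 8).+1 = (trunc_log 2 y).+1 + ((L + 2 * c) + 8) by lia.
rewrite expnD; have hy := trunc_log_ltn y (isT : 1 < 2).
have hR : c + 2 + (4 * L + 4 * c + 20) <= 2 ^ (L + 2 * c + 8).
  rewrite expnD; have := ltn_expl (L + 2 * c) (isT : 1 < 2).
  by rewrite (_ : 2 ^ 8 = 256) //; lia.
have h2 : 2 <= 2 ^ (trunc_log 2 y).+1 by rewrite expnS leq_pmulr // expn_gt0.
move: (2 ^ _) (2 ^ _) hy hR h2 => Z W hy hR h2; nia.
Qed.

Lemma iter_next_bits c L n m0 : m0 <= (c + 2) * n + (4 * L + 4 * c + 20) ->
  iter (logstar n) (next_bits L) m0 <= 4 * L + 5 * c + 22.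
Proof.
move=> h0; have H i : iter i (next_bits L) m0 <=
   (c + 2) * iter i (trunc_log 2) n + (4 * L + 4 * c + 20).
  by elim: i => [//|i IH]; rewrite !iterS; apply: next_bits_bound.
have := H (logstar n); have := logstarP n; nia.
Qed.

Section Colouring.
Variables (n c P : nat).

Definition col_L := (trunc_log 2 P).+1.
Definition col_m0 := c * (trunc_log 2 n).+1.
(** Chosen so that the [4 * col_L + 5 * c + 22] bits left by [lin_rules] are fewer than
    [col_e * col_k], using [col_L < 2 * col_e]. *)
Definition col_k := 5 * c + 31.
Definition col_e := col_L./2.+1.
(** The extra factor [2 ^ (2 * col_k + 2)] is at least four times the square of [col_k], as
    [pk_large] requires. *)
Definition col_ep := col_e + (2 * col_k + 2).
(** Starts with [q * k * d] at most half of [P], halves in each phase, and is 0 in the last one. *)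
Definition col_d j := P %/ (2 * (2 ^ col_e * col_k)) %/ 2 ^ j.

Definition lin_rules : seq (rule state) :=
  [seq lin_rule col_L (iter i (next_bits col_L) col_m0) | i <- iota 0 (logstar n)].
Definition phases i j : seq (rule state) :=
  flatten [seq phase_rules P col_e col_ep col_k (col_d x) | x <- iota i j].
Definition col_rules := lin_rules ++ phases 0 (trunc_log 2 P).+2.
Definition col_init (v : nat) := State v None None None.
Definition colour (N : nat -> seq nat) (v : nat) : nat :=
  odflt 0 (final_col (run N col_rules col_init v)).

Definition col_time J := logstar n + J * (3 * 2 ^ col_ep + 1).

Lemma size_lin_rules : size lin_rules = logstar n.
Proof. by rewrite size_map size_iota. Qed.

Lemma phasesS i j : phases i j.+1 =
  phase_rules P col_e col_ep col_k (col_d i) ++ phases i.+1 j.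
Proof. by []. Qed.

Lemma size_phases i j : size (phases i j) = j * (3 * 2 ^ col_ep + 1).
Proof.
elim: j i => [//|j IH] i; by rewrite phasesS size_cat size_phase_rules IH mulSn.
Qed.

Lemma colour_local N N' v : agree_upto N N' (col_time (trunc_log 2 P).+2) v ->
  colour N v = colour N' v.
Proof.
move=> h; rewrite /colour (@run_local _ N N' col_rules) //.
by rewrite /col_rules size_cat size_lin_rules size_phases.
Qed.

Lemma phases_keep N i j s v y : final_col (s v) = Some y -> final_col (run N (phases i j) s v) = Some y.
Proof.
elim: j i s => [//|j IH] i s cv; rewrite phasesS run_cat; apply: IH.
exact: phase_keeps.
Qed.

Section Correct.
Variables (N : nat -> seq nat) (V : pred nat).
Hypothesis Nsym : forall u v, u \in N v -> v \in N u.
Hypothesis NV : forall u v, u \in N v -> V u.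
Hypothesis Nirr : forall v, v \notin N v.
Hypothesis Ndeg : forall v, V v -> size (N v) < P.
Hypothesis ids : forall v, V v -> v < n ^ c.

Let q := 2 ^ col_e.

Lemma P_lt_L : P <= 2 ^ col_L.
Proof. exact/ltnW/trunc_log_ltn. Qed.

Lemma P_le_qq : P <= q * q.
Proof.
apply: leq_trans P_lt_L _; rewrite /q -expnD leq_exp2l // /col_e.
by have := odd_double_half col_L; case: odd; lia.
Qed.

Lemma after_lin : good N V P col_e col_k (run N lin_rules col_init) /\
  forall v, final_col (run N lin_rules col_init v) = None.
Proof.
have H i : let s := run N [seq lin_rule col_L (iter i (next_bits col_L) col_m0) | i <- iota 0 i] col_init in
  proper_ids N V (iter i (next_bits col_L) col_m0) s /\ forall v, final_col (s v) = None.
  elim: i => [|i [IH1 IH2]].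
    split=> //; split=> [v /ids /leq_trans|u v uv] /=.
      apply; rewrite /col_m0 mulnC expnM; case: (posnP c) => [->//|c0].
      by rewrite leq_exp2r //; apply/ltnW/trunc_log_ltn.
    by apply: contraTneq uv => ->.
  rewrite -[in iota 0 _]addn1 iotaD map_cat run_cat add0n iterS; split; last first.
    by move=> v; rewrite /= (IH2 v).
  exact: lin_step Nsym NV Ndeg _ _ _ P_lt_L IH1.
have [[h1 h2] h3] := H (logstar n); split=> //.
have hm : iter (logstar n) (next_bits col_L) col_m0 <= 4 * col_L + 5 * c + 22.
  apply: iter_next_bits; rewrite /col_m0.
  have : trunc_log 2 n <= n by case: n => // n'; apply/ltnW/trunc_log_lt_self.
  by move: (trunc_log 2 n) => a; nia.
split=> //.
- move=> v Vv; apply: (@leq_ltn_trans (2 ^ (4 * col_L + 5 * c + 22))).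
    by apply: leq_trans (h1 v Vv) _; rewrite leq_exp2l.
  rewrite ltn_exp2l // /col_e /col_k.
  by have := odd_double_half col_L; case: odd; nia.
- by move=> v y _; rewrite -/lin_rules h3.
Qed.

Let p := 2 ^ col_ep.
Let k := col_k.

Lemma pk_large : 2 * k * (2 * (q * k)) <= p.
Proof.
rewrite /p /col_ep expnD -/q -/k.
have -> : 2 * k * (2 * (q * k)) = q * (4 * (k * k)) by nia.
have : k * k <= 2 ^ (2 * k).
  by rewrite mul2n -addnn expnD; apply: leq_mul; apply/ltnW/ltn_expl.
rewrite leq_mul2l expnD (_ : 2 ^ 2 = 4) // => h; apply/orP; right; lia.
Qed.

Let qk0 : 0 < q * k. Proof. by rewrite muln_gt0 expn_gt0 /k /col_k addnS. Qed.

Lemma phase_once j D s : good N V P col_e k s ->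
  (forall v, V v -> final_col (s v) = None -> udeg N s v <= D) -> 2 * k * D < p * (col_d j).+1 ->
  let s' := run N (phases j 1) s in
  good N V P col_e k s' /\ forall v, V v -> final_col (s' v) = None ->
     udeg N s' v < q * k * col_d j /\ P - size (N v) <= q * k * col_d j.
Proof.
move=> h1 h2 h3; rewrite phasesS cats0.
apply: phase_spec h1 h2 h3 => //; [exact: leq_addr | exact: P_le_qq].
Qed.

Lemma run_phasesS N' j s : run N' (phases 0 j.+1) s = run N' (phases j 1) (run N' (phases 0 j) s).
Proof. by rewrite -run_cat /phases -addn1 iotaD map_cat flatten_cat. Qed.

(** The first phase starts from the trivial bound [P] on the degree. Each later one starts from the
    bound [q * k * col_d j] left by its predecessor, which suffices because
    [col_d j < 2 * (col_d j.+1).+1]. *)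
Lemma after_phases j : let s := run N (phases 0 j.+1) (run N lin_rules col_init) in
  good N V P col_e k s /\ forall v, V v -> final_col (s v) = None ->
     udeg N s v < q * k * col_d j /\ P - size (N v) <= q * k * col_d j.
Proof.
elim: j => [|j [IH1 IH2]]; last first.
  rewrite run_phasesS; apply: (phase_once IH1 (D := q * k * col_d j)).
    by move=> v Vv cv; apply: ltnW; case: (IH2 v Vv cv).
  have := pk_large.
  have : col_d j < 2 * (col_d j.+1).+1.
    have -> : col_d j.+1 = col_d j %/ 2 by rewrite /col_d expnSr divnMA.
    by lia.
  by move: (col_d j) (col_d j.+1) qk0 => a b; move: (q * k) => w; nia.
have [g h] := after_lin; apply: (phase_once g (D := P)).
  by move=> v Vv _; apply: leq_trans (count_size _ _) _; apply/ltnW/Ndeg.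
have := pk_large; have : P < 2 * (q * k) * (col_d 0).+1.
  by rewrite /col_d expn0 divn1 mulnC; apply: ltn_ceil; rewrite muln_gt0.
move: (col_d 0) qk0 => a; move: (q * k) => w; nia.
Qed.

Lemma colour_spec v : V v -> colour N v < P /\ forall u, u \in N v -> colour N u != colour N v.
Proof.
rewrite /colour /col_rules run_cat.
have [[_ _ hg] h] := after_phases (trunc_log 2 P).+1.
set s := run N _ _ in hg h *.
have d0 : col_d (trunc_log 2 P).+1 = 0.
  apply: divn_small; apply: leq_ltn_trans (leq_div _ _) _; exact: trunc_log_ltn.
have all w : V w -> exists y, final_col (s w) = Some y.
  move=> Vw; case E: (final_col (s w)) => [y|]; first by exists y.
  by have [] := h w Vw E; rewrite d0 muln0.
move=> Vv; have [y cv] := all v Vv; have [yP hn] := hg v y Vv cv.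
rewrite cv; split=> // u uv; have [z cu] := all u (NV uv).
by have := hn u uv; rewrite cu.
Qed.

(** A vertex left uncoloured by the first phase would have [P - size (N v)] at most half of [P],
    against the degree hypothesis. A colour once given survives later phases even under the
    unrelated adjacency [N']. *)
Lemma colour_early N' v : V v -> 2 * size (N v) < P ->
  agree_upto N N' (col_time 1) v -> colour N v = colour N' v.
Proof.
move=> Vv hs hag.
have [_] := after_phases 0; rewrite -run_cat; set A := lin_rules ++ _ => h.
rewrite /colour (_ : col_rules = A ++ phases 1 (trunc_log 2 P).+1); last first.
  by rewrite /col_rules /A phasesS (phasesS 0 0) cats0 catA.
have e : run N A col_init v = run N' A col_init v.
  by apply: run_local; rewrite size_cat size_lin_rules size_phases.
rewrite !(run_cat _ A); case E: (final_col (run N A col_init v)) => [y|].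
  by rewrite !(@phases_keep _ _ _ _ _ y) // -e.
have [_] := h v Vv E; rewrite {1}/col_d expn0 divn1.
have := leq_trunc_div P (2 * (q * k)); rewrite -/q -/k.
move: (P %/ _) => a; nia.
Qed.
End Correct.
End Colouring.

(** * Views and stopping times *)

Lemma within_V G k v u : wf_net G -> within G k v u -> u \in nV G.
Proof.
move=> [_ _ _ he]; elim: k u => [|k IH] u /=; first by case/andP => /eqP ->.
by case/orP => [/IH//|/hasP[w _ /andP[_ /he/andP[]]]].
Qed.

Lemma within0 G v : v \in nV G -> within G 0 v v.
Proof. by rewrite /= eqxx. Qed.

Lemma withinS G k v u : wf_net G ->
  within G k.+1 v u <-> within G k v u \/ exists2 w, within G k v w & nE G w u.
Proof.
move=> wf; split=> /= [/orP[->|/hasP[w _ /andP[h1 h2]]]|[->//|[w h1 h2]]]; first by left.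
  by right; exists w.
by apply/orP; right; apply/hasP; exists w; rewrite ?h1 // (within_V wf h1).
Qed.

Lemma within_leq G j k v u : j <= k -> within G j v u -> within G k v u.
Proof. by move=> /subnKC <-; elim: (k - j) => [|m IH] h; rewrite ?addn0 // addnS /= IH. Qed.

Lemma within_trans G a b v u w : wf_net G ->
  within G a v u -> within G b u w -> within G (a + b) v w.
Proof.
move=> wf hu; elim: b w => [|b IH] w; first by rewrite addn0 => /andP[/eqP ->].
rewrite addnS => /(withinS _ _ _ wf) [/IH h|[z /IH h hz]]; apply/withinS => //; first by left.
by right; exists z.
Qed.

Lemma within1 G v u : wf_net G -> nE G v u -> within G 1 v u.
Proof.
by move=> wf h; apply/withinS => //; right; exists v => //; apply: within0; case: wf => _ _ _ /(_ _ _ h)/andP[].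
Qed.

Lemma same_view_sub G1 G2 a b v u : wf_net G1 -> wf_net G2 ->
  same_view G1 G2 (a + b) v -> within G1 b v u -> same_view G1 G2 a u.
Proof.
move=> wf1 wf2 [hw he] hu.
have hu1 j : j <= a -> forall w, within G1 j u w -> within G1 (b + j) v w.
  by move=> _ w; apply: within_trans.
have eqw j : j <= a -> forall w, within G1 j u w = within G2 j u w.
  elim: j => [|j IH] ja w.
    rewrite /=; have u1 := within_V wf1 hu; have u2 : u \in nV G2.
      by apply: (within_V wf2 (k := a + b) (v := v)); rewrite -hw; apply: within_leq hu; apply: leq_addl.
    by rewrite u1 u2.
  have IHj := IH (ltnW ja).
  have eE z : within G1 j u z -> nE G1 z w = nE G2 z w.
    move=> hz; apply: he; first by lia.
    by apply: within_leq (hu1 j (ltnW ja) _ hz); lia.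
  apply/idP/idP => /withinS h; apply/withinS => //; case: (h _) => // [|[z hz ez]].
  - by rewrite IHj; left.
  - by right; exists z; rewrite -?IHj // -eE.
  - by rewrite IHj; left.
  - by right; exists z; rewrite ?IHj // eE // IHj.
split; first exact: eqw.
move=> z w a0 hz; apply: he; first by lia.
by apply: within_leq (hu1 _ (leq_pred a) _ hz); lia.
Qed.

Lemma same_viewW G1 G2 a r v : wf_net G1 -> wf_net G2 -> v \in nV G1 -> a <= r ->
  same_view G1 G2 r v -> same_view G1 G2 a v.
Proof.
move=> wf1 wf2 Vv ar h; apply: (@same_view_sub _ _ a (r - a) v) => //.
  by rewrite subnKC.
exact: within_leq (within0 Vv).
Qed.

Lemma same_view_V G1 G2 r v : v \in nV G1 -> same_view G1 G2 r v -> wf_net G2 -> v \in nV G2.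
Proof.
by move=> Vv [h _] wf2; apply: (within_V wf2 (k := r) (v := v)); rewrite -h; apply: within_leq (within0 Vv).
Qed.

Lemma same_view_sym G1 G2 r v : wf_net G1 -> wf_net G2 -> v \in nV G1 ->
  same_view G1 G2 r v -> same_view G2 G1 r v.
Proof.
move=> wf1 wf2 Vv h; split=> [u|u w r0]; first by case: h => ->.
have [h1 _] := same_viewW wf1 wf2 Vv (leq_pred r) h.
by rewrite -h1 => hu; case: h => _ -> .
Qed.

Lemma same_view_trans G1 G2 G3 r v : wf_net G1 -> wf_net G2 -> v \in nV G1 ->
  same_view G1 G2 r v -> same_view G2 G3 r v -> same_view G1 G3 r v.
Proof.
move=> wf1 wf2 Vv h h'; split=> [u|u w r0 hu].
  by case: h => ->; case: h' => ->.
have [h1 _] := same_viewW wf1 wf2 Vv (leq_pred r) h.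
by case: h => _ -> //; case: h' => _ -> //; rewrite -h1.
Qed.

Definition determines (out : net -> nat -> nat) (G : net) (v r : nat) : Prop :=
  forall G', wf_net G' -> same_view G G' r v -> out G' v = out G v.

(* The value [0] in the absence of any determining radius breaks locality, so
   [stop_time_local] needs some [r]. *)
Definition stop_time (out : net -> nat -> nat) (G : net) (v : nat) : nat :=
  if pselect (exists r, `[< determines out G v r >]) is left h then ex_minn h else 0.

Lemma stop_time_min out G v r : determines out G v r -> stop_time out G v <= r.
Proof.
rewrite /stop_time => /asboolP h; case: pselect => // e.
by case: ex_minnP => m _; apply.
Qed.

(** Determination passes between networks with the same view. A smaller determining radius in [G2]
    would therefore determine the output in [G1] as well, against minimality. *)
Lemma stop_time_local out G1 G2 v r :
  wf_net G1 -> wf_net G2 -> v \in nV G1 -> determines out G1 v r ->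
  same_view G1 G2 (stop_time out G1 v) v ->
  stop_time out G2 v = stop_time out G1 v /\ out G2 v = out G1 v.
Proof.
move=> wf1 wf2 Vv dr hs.
have [d1 m1] : determines out G1 v (stop_time out G1 v) /\
    forall r, determines out G1 v r -> stop_time out G1 v <= r.
  split; last by move=> *; apply: stop_time_min.
  rewrite /stop_time; case: pselect => [e|[]]; last by exists r; apply/asboolP.
  by case: ex_minnP => m /asboolP.
have oE := d1 _ wf2 hs.
have V2 := same_view_V Vv hs wf2.
have d2 : determines out G2 v (stop_time out G1 v).
  by move=> G' wf' h; rewrite oE; apply: d1 => //; apply: same_view_trans h.
split=> //; apply/eqP; rewrite eqn_leq stop_time_min //=.
rewrite {2}/stop_time; case: pselect => [e|[]]; last by exists (stop_time out G1 v); apply/asboolP.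
case: ex_minnP => m /asboolP hm _; case: leqP => // lt.
suff: determines out G1 v m by move/m1; lia.
move=> G' wf' h; rewrite -oE; apply: hm => //.
apply: same_view_trans h => //.
apply: same_view_sym => //; exact: same_viewW (ltnW lt) hs.
Qed.

(** * Cliques and connectors *)

Lemma mem_subseqs s K : (K \in subseqs s) = subseq K s.
Proof.
elim: s K => [|x s IH] K /=; first by rewrite inE; case: K.
rewrite mem_cat; case: K => [|y K].
  by rewrite IH sub0seq orbT.
rewrite [subseq _ _]/=; case: eqP => [->|ne].
  rewrite mem_map; last by move=> ? ? [].
  rewrite !IH; apply/orP/idP => [[//|h]|->]; last by left.
  by apply: subseq_trans h; apply: subseq_cons.
rewrite IH orb_idl // => /mapP[z _ [e _]]; exact: False_ind (ne e).
Qed.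

Lemma filter_vsubsets G (a : pred nat) : [seq z <- sort leq (nV G) | a z] \in vsubsets G.
Proof. by rewrite mem_subseqs filter_subseq. Qed.

Lemma sort_uniq_eq (s1 s2 : seq nat) (a1 a2 : pred nat) : uniq s1 -> uniq s2 ->
  (forall z, (z \in s1) && a1 z = (z \in s2) && a2 z) ->
  [seq z <- sort leq s1 | a1 z] = [seq z <- sort leq s2 | a2 z].
Proof.
move=> u1 u2 h; apply: (sorted_eq leq_trans anti_leq).
- by apply: (sorted_filter leq_trans); apply: sort_sorted leq_total _.
- by apply: (sorted_filter leq_trans); apply: sort_sorted leq_total _.
apply: uniq_perm; rewrite ?filter_uniq ?sort_uniq // => z.
by rewrite !mem_filter !mem_sort andbC h andbC.
Qed.

Lemma vsubsets_filter G K : uniq (nV G) -> K \in vsubsets G ->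
  K = [seq z <- sort leq (nV G) | z \in K].
Proof.
move=> u hK; have sK : subseq K (sort leq (nV G)) by rewrite -mem_subseqs.
by apply/subseq_uniqP; rewrite ?sort_uniq.
Qed.

Lemma is_cliqueP G K : reflect
  [/\ uniq K, forall u, u \in K -> u \in nV G &
      forall u w, u \in K -> w \in K -> u = w \/ nE G u w] (is_clique G K).
Proof.
rewrite /is_clique; apply: (iffP andP) => [[/andP[u /allP hV] /allP hE]|[u hV hE]].
  split=> // x y hx hy; have /allP/(_ y hy)/orP[/eqP|] := hE x hx; by [left|right].
split; first by rewrite u; apply/allP.
apply/allP => x hx; apply/allP => y hy; apply/orP.
by case: (hE x y hx hy) => [->|]; [left|right].
Qed.

Lemma is_max_cliqueP G K : reflect
  (is_clique G K /\ forall u, u \in nV G -> (forall w, w \in K -> nE G u w) -> u \in K)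
  (is_max_clique G K).
Proof.
rewrite /is_max_clique; apply: (iffP andP) => [[hc /allP h]|[hc h]]; split=> //.
  by move=> u /h /orP[//|/allPn[w hw hn]] /(_ w hw); rewrite (negbTE hn).
apply/allP => u hu; case: (boolP (all _ _)) => [/allP a|_]; last by rewrite orbT.
by rewrite h.
Qed.

Lemma max_clique_ext G K : wf_net G -> is_clique G K ->
  exists K', [/\ K' \in vsubsets G, is_max_clique G K' & {subset K <= K'}].
Proof.
move=> wf; have [uG sym irr _] := wf.
(* Induction on the room left for enlarging [K]; the clique found is then sorted to become a member
   of [vsubsets G]. *)
suff: forall m K, size (nV G) - size K <= m -> is_clique G K ->
    exists2 K', is_max_clique G K' & {subset K <= K'}.
  move=> /(_ _ K (leqnn _)) h /h [K1 /is_max_cliqueP [/is_cliqueP [u1 V1 E1] m1] s1].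
  pose K2 := [seq z <- sort leq (nV G) | z \in K1].
  have e z : (z \in K2) = (z \in K1).
    by rewrite mem_filter mem_sort; apply: andb_idr; apply: V1.
  exists K2; split; first exact: filter_vsubsets.
    apply/is_max_cliqueP; split.
      apply/is_cliqueP; split; first by rewrite filter_uniq ?sort_uniq.
        by move=> u; rewrite e; apply: V1.
      by move=> u w; rewrite !e; apply: E1.
    by move=> u hu h2; rewrite e; apply: m1 => // w; rewrite -e; apply: h2.
  by move=> z /s1; rewrite e.
elim=> [|m IH] {}K hm hK; have /is_cliqueP [u1 V1 E1] := hK.
  all: have le := uniq_leq_size u1 V1.
all: case: (boolP (is_max_clique G K)) => [h|]; first by exists K.
all: rewrite /is_max_clique hK /= => /allPn [u hu]; rewrite negb_or negbK => /andP[nu /allP au].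
all: have hK' : is_clique G (u :: K).
1,3: apply/is_cliqueP; split; first by rewrite /= nu.
1,3: by move=> z; rewrite inE => /orP[/eqP ->|/V1].
1,2: move=> x y; rewrite !inE => /orP[/eqP ->|hx] /orP[/eqP ->|hy]; [by left|by right; apply: au|by right; rewrite sym; apply: au|exact: E1].
all: have /is_cliqueP [u2 V2 _] := hK'; have /= le2 := uniq_leq_size u2 V2.
  by lia.
have [|K' h1 h2] := IH _ _ hK'; first by rewrite /=; lia.
by exists K' => // z hz; apply: h2; rewrite inE hz orbT.
Qed.

Section Connector.
Variable t : nat.

Definition group_of (part : nat -> nat) (K : seq nat) (v : nat) : nat :=
  index v [seq z <- K | part z == part v] %/ t.

Definition connected (G : net) (part : nat -> nat) (v w : nat) : bool :=
  [&& v != w, part v == part w &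
   has (fun K => [&& is_max_clique G K, v \in K, w \in K & group_of part K v == group_of part K w])
     (vsubsets G)].

Definition nbr (G : net) (part : nat -> nat) (v : nat) : seq nat :=
  [seq w <- sort leq (nV G) | nE G v w && connected G part v w].

Lemma nbrP G part v w : wf_net G -> reflect
  [/\ v != w, part v = part w, nE G v w &
   exists K, [/\ K \in vsubsets G, is_max_clique G K, v \in K, w \in K & group_of part K v = group_of part K w]]
  (w \in nbr G part v).
Proof.
move=> wf; rewrite mem_filter mem_sort; apply: (iffP andP).
  case=> /andP[h1 /and3P[h2 /eqP h3 /hasP[K hK /and4P[h4 h5 h6 /eqP h7]]]] _.
  by split=> //; exists K.
case=> h1 h2 h3 [K [h4 h5 h6 h7 h8]]; split; last first.
  by case: wf => _ _ _ /(_ _ _ h3)/andP[].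
rewrite h3 /connected h1 h2 eqxx /=; apply/hasP; exists K => //.
by rewrite h5 h6 h7 h8 eqxx.
Qed.

(** The members of a clique through [v] are at distance at most 1, so radius 2 shows all their
    edges, including any to a vertex that would extend the clique. *)
Lemma max_clique_local G1 G2 v K : wf_net G1 -> wf_net G2 -> same_view G1 G2 2 v ->
  v \in K -> K \in vsubsets G1 -> is_max_clique G1 K ->
  K \in vsubsets G2 /\ is_max_clique G2 K.
Proof.
move=> wf1 wf2 hs vK hK /is_max_cliqueP [/is_cliqueP [u1 V1 E1] m1].
have [uG1 sym1 _ he1] := wf1; have [uG2 sym2 _ he2] := wf2.
have w1 w : w \in K -> within G1 1 v w.
  move=> wK; case: (E1 v w vK wK) => [<-|]; last exact: within1.
  apply: within_leq (within0 _) => //; exact: V1.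
have eE w z : w \in K -> nE G1 w z = nE G2 w z by move=> /w1 hw; case: hs => _; apply.
have V2 w : w \in K -> w \in nV G2.
  move=> wK; apply: (within_V wf2 (k := 2) (v := v)).
  by case: hs => <- _; apply: within_leq (w1 w wK).
split.
  rewrite (vsubsets_filter uG1 hK) (_ : filter _ _ = [seq z <- sort leq (nV G2) | z \in K]).
    exact: filter_vsubsets.
  apply: sort_uniq_eq => // z; case: (boolP (z \in K)) => zK; last by rewrite !andbF.
  by rewrite V1 ?V2.
apply/is_max_cliqueP; split.
  apply/is_cliqueP; split=> // u w uK wK; rewrite -eE //; exact: E1.
move=> u uG2' h; have h1 w : w \in K -> nE G1 u w.
  by move=> wK; rewrite sym1 eE // sym2; apply: h.
by apply: m1 => //; case/andP: (he1 _ _ (h1 v vK)).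
Qed.

Lemma nbr_local G1 G2 part1 part2 v : wf_net G1 -> wf_net G2 -> v \in nV G1 ->
  same_view G1 G2 2 v -> (forall u, within G1 1 v u -> part1 u = part2 u) ->
  nbr G1 part1 v = nbr G2 part2 v.
Proof.
suff half G1' G2' p1 p2 : wf_net G1' -> wf_net G2' -> v \in nV G1' ->
    same_view G1' G2' 2 v -> (forall u, within G1' 1 v u -> p1 u = p2 u) ->
    {subset nbr G1' p1 v <= nbr G2' p2 v}.
  move=> wf1 wf2 Vv hs hp.
  have hs' := same_view_sym wf1 wf2 Vv hs; have V2 := same_view_V Vv hs wf2.
  have [w1 _] := same_viewW wf1 wf2 Vv (isT : 1 <= 2) hs.
  have [uG1 _ _ _] := wf1; have [uG2 _ _ _] := wf2.
  apply: (sorted_eq leq_trans anti_leq).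
  - by apply: (sorted_filter leq_trans); apply: sort_sorted leq_total _.
  - by apply: (sorted_filter leq_trans); apply: sort_sorted leq_total _.
  apply: uniq_perm; rewrite ?filter_uniq ?sort_uniq // => z.
  apply/idP/idP; apply: half => // u; rewrite -w1 => hu; exact/esym/hp.
move=> wf1 wf2 Vv hs hp w /(nbrP _ _ _ wf1) [h1 h2 h3 [K [hK mK vK wK hg]]].
have /is_max_cliqueP [/is_cliqueP [_ V1 E1] _] := mK.
have [hK2 mK2] := max_clique_local wf1 wf2 hs vK hK mK.
have pK z : z \in K -> p1 z = p2 z.
  move=> zK; apply: hp; case: (E1 v z vK zK) => [<-|]; last exact: within1.
  exact: within_leq (within0 Vv).
apply/(nbrP _ _ _ wf2); split=> //.
- by rewrite -!pK.
- case: hs => _ <- //; exact: within_leq (within0 Vv).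
exists K; split=> //; move: hg; rewrite /group_of.
have fE u : u \in K -> [seq z <- K | p1 z == p1 u] = [seq z <- K | p2 z == p2 u].
  by move=> uK; apply: eq_in_filter => z zK; rewrite !pK.
by rewrite !fE.
Qed.

Lemma group_size (A s : seq nat) g : 0 < t -> uniq s -> {subset s <= A} ->
  (forall w, w \in s -> index w A %/ t = g) -> size s <= t.
Proof.
move=> t0 us sA hg; rewrite -(size_map (index^~ A)) -(size_iota (g * t) t).
apply: uniq_leq_size.
  rewrite map_inj_in_uniq // => x y hx hy e.
  by rewrite -(nth_index 0 (sA _ hx)) e nth_index // sA.
move=> _ /mapP[w hw ->]; rewrite mem_iota -(hg w hw).
by rewrite leq_divM /= addnC -mulSn ltn_ceil.
Qed.

Section Wf.
Variables (G : net) (part : nat -> nat).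
Hypothesis wf : wf_net G.

Lemma nbr_sym u v : u \in nbr G part v -> v \in nbr G part u.
Proof.
move=> /(nbrP _ _ _ wf) [h1 h2 h3 [K [hK mK vK wK hg]]]; apply/(nbrP _ _ _ wf).
split=> //; first by rewrite eq_sym.
  by case: wf => _ <-.
by exists K.
Qed.

Lemma nbr_irr v : v \notin nbr G part v.
Proof. by apply/negP => /(nbrP _ _ _ wf) []; rewrite eqxx. Qed.

Lemma nbr_edge u v : u \in nbr G part v -> nE G v u.
Proof. by move=> /(nbrP _ _ _ wf) []. Qed.

Lemma nbr_V u v : u \in nbr G part v -> u \in nV G.
Proof. by rewrite mem_filter mem_sort => /andP[]. Qed.

Lemma nbr_degree v : v \in nV G -> size (nbr G part v) <= max_degree G.
Proof.
move=> Vv; apply: (@leq_trans (size [seq u <- nV G | nE G v u])); last first.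
  exact: (leq_bigmax_seq (F := fun v => size [seq u <- nV G | nE G v u])).
have [uG _ _ _] := wf.
apply: uniq_leq_size; first by rewrite filter_uniq ?sort_uniq.
by move=> u hu; rewrite mem_filter nbr_edge // (nbr_V hu).
Qed.

Lemma diversity_gt0 v : v \in nV G -> 0 < vdiversity G v.
Proof.
move=> Vv; rewrite -has_count.
have [|K [hK mK sK]] := max_clique_ext wf (K := [:: v]).
  apply/is_cliqueP; split=> [//|u|u w]; rewrite !inE => /eqP -> //.
  by move=> /eqP ->; left.
by apply/hasP; exists K => //; rewrite mK sK ?mem_head.
Qed.

(** Each maximal clique through [v] contributes at most [t - 1] neighbours, the rest of the group of
    [v]. Strictness holds because [v] lies in some maximal clique. *)
Lemma nbr_diversity v : 0 < t -> v \in nV G -> size (nbr G part v) < t * diversity G.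
Proof.
move=> t0 Vv.
have le : vdiversity G v <= diversity G by apply: (leq_bigmax_seq (F := vdiversity G)).
apply: leq_trans (_ : t * vdiversity G v <= _); last by rewrite leq_mul2l le orbT.
have d0 := diversity_gt0 Vv.
suff : size (nbr G part v) <= vdiversity G v * t.-1 by nia.
pose Ks := [seq K <- vsubsets G | is_max_clique G K && (v \in K)].
pose B K := [seq w <- K | [&& w != v, part w == part v & group_of part K w == group_of part K v]].
have [uG _ _ _] := wf.
have h1 : size (nbr G part v) <= size (flatten (map B Ks)).
  apply: uniq_leq_size; first by rewrite filter_uniq ?sort_uniq.
  move=> w /(nbrP _ _ _ wf) [h1 h2 h3 [K [hK mK vK wK hg]]].
  apply/flatten_mapP; exists K; first by rewrite mem_filter mK vK.
  by rewrite mem_filter wK eq_sym h1 h2 hg !eqxx.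
apply: leq_trans h1 _; rewrite /vdiversity -size_filter -/Ks.
have : {subset Ks <= Ks} by [].
elim: {1 3 4}Ks => [//|K s IH] hs /=; rewrite size_cat mulSn leq_add //; last first.
  by apply: IH => K' hK'; apply: hs; rewrite inE hK' orbT.
have := hs K (mem_head _ _); rewrite mem_filter => /andP[/andP[mK vK] hK].
have /is_max_cliqueP [/is_cliqueP [uK _ _] _] := mK.
rewrite -ltnS prednK // -/(size (v :: B K)).
apply: (@group_size [seq z <- K | part z == part v] _ (group_of part K v)) => //.
- by rewrite /= mem_filter eqxx /= filter_uniq.
- move=> z; rewrite inE mem_filter => /orP[/eqP ->|]; first by rewrite mem_filter eqxx.
  by rewrite mem_filter => /andP[/and3P[_ -> _] ->].
move=> z; rewrite inE => /orP[/eqP -> //|]; rewrite mem_filter => /andP[/and3P[_ /eqP e /eqP h] _].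
by rewrite -h /group_of e.
Qed.
End Wf.
End Connector.

(** * Iterated refinement *)

Section Stages.
Variables (n c D t : nat).
Let P := t * D.

Fixpoint stage (s : nat) (G : net) (v : nat) : nat :=
  if s is s'.+1 then stage s' G v * P + colour n c P (nbr t G (stage s' G)) v else 0.

Definition colour_determined G T := forall part v N', v \in nV G ->
  agree_upto (nbr t G part) N' T v -> colour n c P (nbr t G part) v = colour n c P N' v.

(** A stage costs 2 rounds for the connector lists and [T] for the colouring. Connector edges are
    edges of [G], so following one moves the centre of the view by distance 1. *)
Lemma stage_determined G T s v : wf_net G -> colour_determined G T -> v \in nV G ->
  determines (stage s) G v (s * (T + 2)).
Proof.
move=> wf hT; elim: s v => [//|s IH] v Vv G' wf' hs /=.
have e1 := IH v Vv G' wf' (same_viewW wf wf' Vv (leq_mul (leqnSn s) (leqnn _)) hs).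
rewrite e1; congr (_ + _); apply/esym/hT => //.
have: same_view G G' (s * (T + 2) + 2 + T) v by rewrite (_ : _ + T = s.+1 * (T + 2)) //; lia.
move: T {hT hs e1 IH} (IH) => T IH.
have H j u : u \in nV G -> same_view G G' (s * (T + 2) + 2 + j) u ->
    agree_upto (nbr t G (stage s G)) (nbr t G' (stage s G')) j u.
  elim: j u => [//|j IHj] u Vu hu; split.
    apply: nbr_local => //; first by apply: same_viewW hu => //; lia.
    move=> w hw; apply/esym/IH => //; first exact: within_V hw.
    apply: (@same_view_sub _ _ _ 1 u) => //; apply: same_viewW hu => //; lia.
  move=> w hw; apply: IHj; first exact: nbr_V hw.
  apply: (@same_view_sub _ _ _ 1 u) => //; first by rewrite -addnA addn1.
  by apply: within1 => //; apply: nbr_edge hw.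
exact: H.
Qed.

Lemma colour_determined_full G : colour_determined G (col_time n c P (trunc_log 2 P).+2).
Proof. by move=> part v N' _; apply: colour_local. Qed.

Section Valid.
Variable G : net.
Hypothesis wf : wf_net G.
Hypothesis ids : forall u, u \in nV G -> u < n ^ c.
Hypothesis GD : diversity G = D.
Hypothesis t0 : 0 < t.

Lemma stage_colour part v : v \in nV G ->
  colour n c P (nbr t G part) v < P /\
  forall u, u \in nbr t G part v ->
    colour n c P (nbr t G part) u != colour n c P (nbr t G part) v.
Proof.
apply: (@colour_spec n c P (nbr t G part) (fun v => v \in nV G)) => //.
- by move=> u w; apply: nbr_sym.
- by move=> u w; apply: nbr_V.
- exact: nbr_irr.
- by move=> w Vw; rewrite /P -GD; apply: nbr_diversity.
Qed.

Lemma colour_determined_early : 2 * max_degree G < P ->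
  colour_determined G (col_time n c P 1).
Proof.
move=> hP part v N' Vv; apply: (@colour_early n c P (nbr t G part) (fun v => v \in nV G)) => //.
- by move=> u w; apply: nbr_sym.
- by move=> u w; apply: nbr_V.
- exact: nbr_irr.
- by move=> w Vw; rewrite /P -GD; apply: nbr_diversity.
- by apply: leq_ltn_trans hP; rewrite leq_mul2l nbr_degree.
Qed.

Lemma stage_lt s v : v \in nV G -> stage s G v < P ^ s.
Proof.
move=> Vv; elim: s => [//|s IH] /=; rewrite expnSr.
by have [h _] := stage_colour (stage s G) Vv; nia.
Qed.

(* The count is ceil(S / t^s) at worst, as ceil(ceil(a / b) / c) = ceil(a / (b c)). *)
Lemma stage_clique s K i : K \in vsubsets G -> is_max_clique G K ->
  size [seq u <- K | stage s G u == i] * t ^ s < clique_number G + t ^ s.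
Proof.
move=> hK mK; have /is_max_cliqueP [cK _] := mK; have /is_cliqueP [uK VK EK] := cK.
elim: s i => [|s IH] i.
  rewrite muln1 addn1 ltnS; apply: leq_trans (_ : size K <= _).
    by rewrite size_filter count_size.
  exact: (leq_bigmax_seq (P := is_clique G) (F := size)).
set B := filter _ K.
case: (posnP (size B)) => [->|B0]; first by rewrite mul0n addn_gt0 expn_gt0 t0 orbT.
pose A := [seq u <- K | stage s G u == i %/ P].
pose col u := colour n c P (nbr t G (stage s G)) u.
have hB u : u \in B -> [/\ u \in K, stage s G u = i %/ P & col u = i %% P].
  rewrite mem_filter => /andP[/eqP <- uK']; split=> //=.
    have [h _] := stage_colour (stage s G) (VK u uK').
    by rewrite divnMDl ?divn_small ?addn0 //; lia.
  have [h _] := stage_colour (stage s G) (VK u uK').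
  by rewrite modnMDl modn_small.
have BA : {subset B <= A} by move=> u /hB [uK' e _]; rewrite mem_filter e eqxx.
have grE u : u \in B -> group_of t (stage s G) K u = index u A %/ t.
  by move=> /hB [_ e _]; rewrite /group_of e.
have uB : uniq B by rewrite filter_uniq.
have A0 : 0 < size A by case: B B0 BA {hB grE uB} => // u B' _ /(_ u (mem_head _ _)); case: A.
(* Two members of [B] in one group would be joined in the connector and differ in colour. So [B] has
   at most one member in each of the [(size A).-1 %/ t + 1] groups of [A]. *)
have sB : size B <= (size A).-1 %/ t + 1.
  rewrite -(size_map (group_of t (stage s G) K) B) -[X in _ <= X](size_iota 0).
  apply: uniq_leq_size.
    rewrite map_inj_in_uniq // => u w hu hw e; apply/eqP; apply/negP => /negP ne.
    have [ku su cu] := hB u hu; have [kw sw cw] := hB w hw.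
    have [_ /(_ w)] := stage_colour (stage s G) (VK u ku).
    rewrite -/(col u) -/(col w) cu cw eqxx => h; suff: false by []; apply: h.
    apply/nbrP => //; split=> //; first by rewrite su sw.
      by case: (EK u w ku kw) => // e'; rewrite e' eqxx in ne.
    by exists K.
  move=> _ /mapP[u hu ->]; rewrite mem_iota /= add0n addn1 ltnS grE //; apply: leq_div2r.
  by rewrite -ltnS prednK // index_mem BA.
have := IH (i %/ P); rewrite -/A expnS.
have ts0 : 0 < t ^ s by rewrite expn_gt0 t0.
have hb : size B * t <= (size A).-1 + t.
  apply: leq_trans (leq_mul sB (leqnn t)) _; rewrite mulnDl mul1n leq_add2r; exact: leq_trunc_div.
have -> : size B * (t * t ^ s) = (size B * t) * t ^ s by rewrite mulnA.
move: (t ^ s) ts0 => w w0 h.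
apply: leq_ltn_trans (leq_mul hb (leqnn w)) _; rewrite mulnDl -[t * w]/(t * w) ltn_add2r.
by case: (size A) A0 h => // a _ /=; lia.
Qed.

Lemma stage_decomp x : is_clique_decomp_frac G (stage x G) (P ^ x) (clique_number G) (t ^ x).
Proof.
split=> [v|K cK i /allP hi]; first exact: stage_lt.
have [K' [hK' mK' sK]] := max_clique_ext wf cK.
have /is_cliqueP [uK _ _] := cK.
have : size K <= size [seq u <- K' | stage x G u == i].
  by apply: uniq_leq_size => // u hu; rewrite mem_filter hi // sK.
move=> h; apply: leq_trans (leq_mul h (leqnn _)) _.
apply: leq_trans (ltnW (stage_clique x i hK' mK')) _.
by rewrite leq_add2l leq_pmull.
Qed.
End Valid.
End Stages.

(** * Round count and conclusion *)

Definition time_const c := 36 * 2 ^ (2 * col_k c + 2) + 5.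

Lemma col_time_bound n c P J : 0 < P ->
  col_time n c P J + 2 <=
  (Nat.sqrt P + logstar n) * (J * (18 * 2 ^ (2 * col_k c + 2) + 1) + 3).
Proof.
move=> P0; rewrite /col_time /col_ep expnD; set W := 2 ^ (2 * col_k c + 2).
have [h1 h2] := PeanoNat.Nat.sqrt_spec P (PeanoNat.Nat.le_0_l P).
have s0 : 0 < Nat.sqrt P by move: h2; move: (Nat.sqrt P) => s; case: s => //; lia.
(* The square of the left side is at most [8 * P], and [P] is at most 3 times the square of
   [Nat.sqrt P], since this root is positive. *)
have he : 2 ^ col_e P <= 6 * Nat.sqrt P.
  have : 2 ^ col_e P * 2 ^ col_e P <= 8 * P.
    rewrite -expnD; apply: (@leq_trans (2 ^ (3 + trunc_log 2 P))).
      rewrite leq_exp2l // /col_e /col_L.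
      by have := odd_double_half (trunc_log 2 P).+1; lia.
    by rewrite expnD leq_mul // trunc_logP.
  move: h1 h2 s0; move: (Nat.sqrt P) (2 ^ _) => s z; nia.
have : 3 * (2 ^ col_e P * W) + 1 <= Nat.sqrt P * (18 * W + 1) by nia.
move: (Nat.sqrt P) s0 => s s0; move: (3 * _ + 1) (18 * W + 1) (logstar n) => a b l h.
have : J * a <= J * (s * b) by rewrite leq_mul.
nia.
Qed.

Lemma full_phases_bound P d : P <= 2 * d -> 0 < P ->
  (trunc_log 2 P).+2 <= 2 * (trunc_log 2 d + 2).
Proof.
move=> h P0.
suff : trunc_log 2 P <= trunc_log 2 d + 1 by lia.
apply: leq_trans (leq_trunc_log 2 h) _.
by rewrite mul2n trunc_log2_double ?addn1 //; lia.
Qed.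

Theorem mainTheorem4 :
  forall c : nat,
  exists C k : nat,
  exists rad out : nat -> nat -> nat -> nat -> nat -> net -> nat -> nat,
    (* locality: vertex v stops after rad(...) rounds and its stopping time
       and output are functions of its view at that time *)
    (forall n D S t x (G1 G2 : net) (v : nat),
        wf_net G1 -> wf_net G2 -> v \in nV G1 ->
        same_view G1 G2 (rad n D S t x G1 v) v ->
        rad n D S t x G2 v = rad n D S t x G1 v /\
        out n D S t x G2 v = out n D S t x G1 v) /\
    (forall n D S t x (G : net),
        wf_net G -> size (nV G) = n ->
        (forall u, u \in nV G -> u < n ^ c) ->
        diversity G = D -> clique_number G = S ->
        2 <= t -> 1 <= x ->
        is_clique_decomp_frac G (out n D S t x G) ((t * D) ^ x) S (t ^ x) /\
        (forall v, v \in nV G ->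
           rad n D S t x G v <=
           C * x * (Nat.sqrt (D * t) + logstar n) * (trunc_log 2 (max_degree G) + 2) ^ k)).
Proof.
move=> c; exists (time_const c), 1.
exists (fun n D S t x => stop_time (stage n c D t x)), (fun n D S t x => stage n c D t x).
split=> [n D S t x G1 G2 v wf1 wf2 Vv|n D S t x G wf hn ids GD GS t2 x1].
  apply: stop_time_local => //; apply: stage_determined => //.
  exact: colour_determined_full.
have t0 : 0 < t by exact: ltnW.
split=> [|v Vv]; first by rewrite -GS; apply: stage_decomp.
have P0 : 0 < t * D.
  rewrite muln_gt0 t0 -GD; apply: leq_trans (diversity_gt0 wf Vv) _.
  exact: (leq_bigmax_seq (F := vdiversity G)).
(* Either one phase determines the colours, or [t * D] is at most twice the maximum degree and all
   phases together are logarithmic in number. Only the analysis distinguishes the cases, not the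
   algorithm. *)
have [J hJ hT] : exists2 J, J <= 2 * (trunc_log 2 (max_degree G) + 2) &
    colour_determined n c D t G (col_time n c (t * D) J).
  case: (ltnP (2 * max_degree G) (t * D)) => h.
    by exists 1; [lia | apply: colour_determined_early].
  by exists (trunc_log 2 (t * D)).+2; [apply: full_phases_bound | apply: colour_determined_full].
apply: leq_trans (stop_time_min (stage_determined wf hT Vv)) _.
rewrite expn1 (mulnC D t) [_ * x]mulnC -!mulnA leq_mul2l; apply/orP; right.
apply: leq_trans (col_time_bound n c J P0) _.
rewrite mulnCA leq_mul2l /time_const; apply/orP; right.
move: (2 ^ _) (trunc_log 2 (max_degree G)) hJ => W l hJ.
(* The constant [36 * W + 5] is [2 * (18 * W + 1)] plus the 3 from [col_time_bound]. *)
have : J * (18 * W + 1) <= 2 * (l + 2) * (18 * W + 1) by rewrite leq_mul.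
nia.
Qed.
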